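(* Let $(X,Z,M_1,M_0,Y_1,Y_0)$ be random variables with $X\in\mathbb{X}\subseteq\mathbb{R}^{d_X}$, $Z\in\{0,1\}$, $M_1,M_0,Y_1,Y_0\in\mathbb{R}$; $M=ZM_1+(1-Z)M_0$, $Y=ZY_1+(1-Z)Y_0$, $U=(M_1,M_0)$. Assume (A1) $Z\perp\!\!\!\perp(M_0,M_1,Y_0,Y_1)\mid X$; (A2) $\mathbb{E}(Y_z\mid X,U=u)=\mathbb{E}(Y_z\mid X,M_z=m_z)$ for all $z\in\{0,1\}$, $u=(m_1,m_0)\in\mathbb{R}^2$; (A3) $e_u(x)=c_\rho\{F(M_1=m_1\mid X=x),F(M_0=m_0\mid X=x)\}\prod_{z}f(M_z=m_z\mid X=x)$ for all $x$, $u=(m_1,m_0)$. Given $u^*\in\mathbb{R}^2$, a kernel $\mathcal{K}$ and a bandwidth $h>0$, the local principal causal effect is identified as $$\tau_{u^*}=\frac{\mathbb{E}\Big[\int_{\mathbb{R}^2}\{\mu_1(X,m_1)-\mu_0(X,m_0)\}e_u(X)k_{u^*}(u)\,du\Big]}{\mathbb{E}\Big[\int_{\mathbb{R}^2}e_u(X)k_{u^*}(u)\,du\Big]},$$ where $e_u(X)=c_\rho\{F_{1m_1}(X),F_{0m_0}(X)\}\prod_{z\in\{0,1\}}f_{zm_z}(X)$ for $u=(m_1,m_0)$.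
   Context: $\mu_z(x,m)=\mathbb{E}(Y\mid X=x,Z=z,M=m)$; $e_u(x)=f(U=u\mid X=x)$ (conditional density of $U$ given $X$); $f_{zm}(x)=f(M=m\mid X=x,Z=z)$, $F_{zm}(x)=\mathbb{P}(M\le m\mid X=x,Z=z)$; $c_\rho$ is a specified bivariate copula density with specified parameter $\rho$; $F(M_z=\cdot\mid X=x)$, $f(M_z=\cdot\mid X=x)$ are conditional CDF/density of $M_z$ given $X=x$. For $u^*=(m_1^*,m_0^* )$, $k_{u^*}(u)=h^{-2}\mathcal{K}\{h^{-1}(m_1-m_1^* ),h^{-1}(m_0-m_0^* )\}$, and $\tau_{u^*}=\mathbb{E}[\{\mu_1(X,M_1)-\mu_0(X,M_0)\}k_{u^*}(U)]/\mathbb{E}\{k_{u^*}(U)\}$. *)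

(* Defs.v *)
From HB Require Import structures.
From mathcomp Require Import all_boot all_order all_algebra.
From mathcomp Require Import all_classical all_reals all_analysis.
Set Implicit Arguments. Unset Strict Implicit. Unset Printing Implicit Defensive.
Import Order.TTheory GRing.Theory Num.Theory.
Local Open Scope classical_set_scope.
Local Open Scope ring_scope.

(** [g] is a version of the conditional expectation E(Y | V, E) restricted to
    the (measurable) event E, i.e. g(v) = E(Y | V = v, E):
    for every measurable B, E[Y 1{E, V in B}] = E[g(V) 1{E, V in B}]. *)
Definition is_cond_exp_on {d dS : measure_display} {T : measurableType d}
  {S : measurableType dS} {R : realType} (P : probability T R)
  (E : set T) (Y : T -> R) (V : T -> S) (g : S -> R) : Prop :=
  [/\ measurable E, measurable_fun setT g,
      P.-integrable E (EFin \o Y),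
      P.-integrable E (EFin \o (g \o V)) &
      forall B, measurable B ->
        (\int[P]_(w in E `&` V @^-1` B) (Y w)%:E
         = \int[P]_(w in E `&` V @^-1` B) (g (V w))%:E)%E].

(** [f] is a version of the conditional density (w.r.t. the measure [mu]) of
    W given V on the event E: f(v, .) is the density of W given V = v, E, i.e.
    P(E, V in A, W in B) = E[ 1{E, V in A} \int_B f(V, y) mu(dy) ]. *)
Definition is_cond_density_on {d dS dW : measure_display} {T : measurableType d}
  {S : measurableType dS} {W : measurableType dW} {R : realType}
  (P : probability T R) (E : set T) (Wv : T -> W) (V : T -> S)
  (mu : {measure set W -> \bar R}) (f : S -> W -> R) : Prop :=
  [/\ measurable E,
      measurable_fun setT (fun p : S * W => f p.1 p.2),
      (forall s y, 0 <= f s y) &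
      forall A B, measurable A -> measurable B ->
        P (E `&` V @^-1` A `&` Wv @^-1` B)
        = (\int[P]_(w in E `&` V @^-1` A) \int[mu]_(y in B) (f (V w) y)%:E)%E].

(** Conditional independence of Z and W given X:
    P(Z = z, W in C | X) = P(Z = z | X) P(W in C | X) a.s., for all z and all
    measurable C (the events of sigma(Z) other than {Z = z} are trivial). *)
Definition cond_indep {d dX dW : measure_display} {T : measurableType d}
  {TX : measurableType dX} {TW : measurableType dW} {R : realType}
  (P : probability T R) (Z : T -> bool) (W : T -> TW) (X : T -> TX) : Prop :=
  forall (z : bool) (C : set TW), measurable C ->
  forall g1 g2 g12 : TX -> R,
    is_cond_exp_on P setT (fun w => \1_[set w' | Z w' = z] w) X g1 ->
    is_cond_exp_on P setT (fun w => \1_C (W w)) X g2 ->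
    is_cond_exp_on P setT
      (fun w => \1_[set w' | Z w' = z] w * \1_C (W w)) X g12 ->
    {ae P, forall w, g12 (X w) = g1 (X w) * g2 (X w)}.

Definition obs {T : Type} {R : realType} (Z : T -> bool) (A1 A0 : T -> R)
  (w : T) : R := if Z w then A1 w else A0 w.

Definition pot {T : Type} {R : realType} (z : bool) (A1 A0 : T -> R) : T -> R :=
  if z then A1 else A0.

Definition leb2 (R : realType)
  : {measure set (measurableTypeR R * measurableTypeR R)%type -> \bar R} :=
  ((@lebesgue_measure R) \x (@lebesgue_measure R))%E.
Arguments leb2 R : clear implicits.

Definition is_copula_density {R : realType} (c : R -> R -> R) : Prop :=
  [/\ measurable_fun setT (fun p : R * R => c p.1 p.2),
      (forall a b, 0 <= c a b),
      (forall a b, ~ (0 <= a <= 1 /\ 0 <= b <= 1) -> c a b = 0),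
      (forall a : R, 0 <= a <= 1 ->
         (\int[leb2 R]_(p in [set p : R * R | (0 <= p.1 <= a) && (0 <= p.2 <= 1)]%R) (c p.1 p.2)%:E
          = a%:E)%E) &
      (forall b : R, 0 <= b <= 1 ->
         (\int[leb2 R]_(p in [set p : R * R | (0 <= p.1 <= 1) && (0 <= p.2 <= b)]%R) (c p.1 p.2)%:E
          = b%:E)%E)].

Definition is_kernel2 {R : realType} (K : R -> R -> R) : Prop :=
  [/\ measurable_fun setT (fun p : R * R => K p.1 p.2),
      (leb2 R).-integrable setT (fun p : R * R => (K p.1 p.2)%:E) &
      (\int[leb2 R]_(p in setT) (K p.1 p.2)%:E = 1)%E].

Definition kwt {R : realType} (K : R -> R -> R) (h : R) (us u : R * R) : R :=
  h ^- 2 * K (h^-1 * (u.1 - us.1)) (h^-1 * (u.2 - us.2)).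

Definition e_id {TX : Type} {R : realType} (c : R -> R -> R)
  (F f : bool -> TX -> R -> R) (x : TX) (u : R * R) : R :=
  c (F true x u.1) (F false x u.2) * (f true x u.1 * f false x u.2).

(* Main.v *)
(** A conditional density [e] of [U] given [X] turns the joint law of [(X, U)]
    into the measure with density [e] with respect to (law of X) \x Lebesgue, so
    E[phi(X, U)] = E[\int phi(X, u) e(X, u) du] for every integrable
    [phi(X, U)]; this is applied to the numerator and to the denominator of the
    causal effect. It remains to see that the observable [e_id] agrees with [e]
    for almost every x and u, i.e. that F, f agree with F(M_z | X), f(M_z | X).
    By (A1), a version g of P(M_z in B | X) satisfies
    P(Z = z, M_z in B, X in A) = E[1{Z = z, X in A} g(X)], so both sides are
    versions of the same object given X and Z = z; hence they agree almost
    surely on {Z = z}, and overlap makes an X-event that is null on {Z = z}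
    null. *)
Require Import Defs.
From HB Require Import structures.
From mathcomp Require Import all_boot all_order all_algebra.
From mathcomp Require Import all_classical all_reals all_analysis.
From mathcomp Require Import measurable_realfun.
Import Order.TTheory GRing.Theory Num.Theory.
Local Open Scope classical_set_scope.
Local Open Scope ring_scope.

(** * Integration against a measure given by a density *)

Section density.
Context {d : measure_display} {T : measurableType d} {R : realType}.
Context (mu : {sigma_finite_measure set T -> \bar R}).
Context (nu : {finite_measure set T -> \bar R}) (g : T -> R).
Hypothesis g0 : forall x, 0 <= g x.
Hypothesis mg : measurable_fun setT g.
Hypothesis nuE : forall A, measurable A -> (nu A = \int[mu]_(x in A) (g x)%:E)%E.
Local Open Scope ereal_scope.

(** Since [nu] vanishes on [mu]-null sets, change of variables holds with its Radon-Nikodym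
    derivative. That derivative and [g] have the same integral over every measurable set, hence
    agree [mu]-almost everywhere. *)
Lemma density_ge0_integral (D : set T) (phi : T -> \bar R) : measurable D ->
  measurable_fun setT phi -> (forall x, 0 <= phi x) ->
  \int[nu]_(x in D) phi x = \int[mu]_(x in D) (phi x * (g x)%:E).
Proof.
move=> mD mphi phi0.
have numu : nu `<< mu.
  apply/null_content_dominatesP => A mA muA0; rewrite nuE//.
  by apply: null_set_integral => //; apply/measurable_EFinP; exact: measurable_funTS.
rewrite -(Radon_Nikodym_SigmaFinite.change_of_variables numu)//; last first.
  exact: measurable_funTS.
have iRN := Radon_Nikodym_SigmaFinite.f_integrable numu.
have mRN := measurable_int _ iRN.
have mgE : measurable_fun setT (EFin \o g) by exact/measurable_EFinP.
apply: ae_eq_integral => //.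
- by apply: measurable_funTS; exact: emeasurable_funM.
- by apply: measurable_funTS; exact: emeasurable_funM.
- apply: ae_eqe_mul2l; apply: (@ae_eq_subset _ _ _ _ mu setT) => //.
  apply: integral_ae_eq => // E _ mE.
  by rewrite -Radon_Nikodym_SigmaFinite.f_integral// nuE.
Qed.

Lemma density_integrable (phi : T -> R) : measurable_fun setT phi ->
  nu.-integrable setT (EFin \o phi) <->
  mu.-integrable setT (fun x => (phi x * g x)%:E).
Proof.
move=> mphi.
have H : \int[nu]_x `|(phi x)%:E| = \int[mu]_x `|(phi x * g x)%:E|.
  rewrite density_ge0_integral//; last first.
    by apply: measurableT_comp => //; exact/measurable_EFinP.
  by apply: eq_integral => x _; rewrite EFinM abseM (@gee0_abs _ (g x)%:E)// lee_fin.
split=> /integrableP[_ oo]; apply/integrableP; split.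
- by apply/measurable_EFinP; exact: measurable_funM.
- by rewrite -H.
- exact/measurable_EFinP.
- by rewrite H.
Qed.

Lemma density_integral (D : set T) (phi : T -> R) : measurable D ->
  measurable_fun setT phi ->
  \int[nu]_(x in D) (phi x)%:E = \int[mu]_(x in D) (phi x * g x)%:E.
Proof.
move=> mD mphi.
have mphiE : measurable_fun setT (EFin \o phi) by exact/measurable_EFinP.
rewrite integralE [RHS]integralE; congr (_ - _).
- rewrite density_ge0_integral//; last exact: measurable_funepos.
  apply: eq_integral => x _.
  by rewrite !funeposE /= EFinM maxe_pMl ?lee_fin// mul0e.
- rewrite density_ge0_integral//; last exact: measurable_funeneg.
  apply: eq_integral => x _.
  by rewrite !funenegE /= -mulNr EFinM maxe_pMl ?lee_fin// mul0e.
Qed.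

End density.

(** * The law of [X] on an event, left unnormalised: its total mass is [P E] *)

Definition law_on {d d' : measure_display} {T : measurableType d}
    {S : measurableType d'} {R : realType} (P : probability T R) {E : set T}
    (mE : measurable E) (X : {mfun T >-> S}) : set S -> \bar R :=
  fun A => P (E `&` X @^-1` A).

Section law_on.
Context {d d' : measure_display} {T : measurableType d} {S : measurableType d'}.
Context {R : realType} (P : probability T R) {E : set T} (mE : measurable E).
Context (X : {mfun T >-> S}).
Local Open Scope ereal_scope.

Let law_on_pushforward A : law_on P mE X A = pushforward (mrestr P mE) X A.
Proof. by rewrite /law_on /pushforward/= /mrestr setIC. Qed.

Let law_on0 : law_on P mE X set0 = 0.
Proof. by rewrite /law_on preimage_set0 setI0 measure0. Qed.

Let law_on_ge0 A : 0 <= law_on P mE X A.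
Proof. exact: measure_ge0. Qed.

Let law_on_additive : semi_sigma_additive (law_on P mE X).
Proof.
move=> F mF tF mUF; rewrite law_on_pushforward.
under eq_fun do under eq_bigr do rewrite law_on_pushforward.
exact: measure_semi_sigma_additive.
Qed.

HB.instance Definition _ := isMeasure.Build _ _ _ (law_on P mE X)
  law_on0 law_on_ge0 law_on_additive.

Let law_on_fin : fin_num_fun (law_on P mE X).
Proof.
move=> A mA; apply: fin_num_measure; apply: measurableI => //.
exact: measurable_funPTI.
Qed.

HB.instance Definition _ := Measure_isFinite.Build _ _ _ (law_on P mE X) law_on_fin.

(** The law on [E] is the image under [X] of the restriction of [P] to [E], and this restriction has
    density [\1_E] with respect to [P]. *)
Lemma ge0_integral_law_on A (g : S -> \bar R) : measurable A ->
  measurable_fun setT g -> (forall x, 0 <= g x) ->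
  \int[law_on P mE X]_(x in A) g x = \int[P]_(w in E `&` X @^-1` A) g (X w).
Proof.
move=> mA mg g0.
have mXA : measurable (X @^-1` A) by exact: measurable_funPTI.
rewrite (eq_measure_integral (pushforward (mrestr P mE) X)); last first.
  by move=> B mB _; exact: law_on_pushforward.
rewrite ge0_integral_pushforward//; last exact: measurable_funTS.
have PE : P E < +oo by rewrite ltey_eq fin_num_measure.
have mgX : measurable_fun setT (g \o X) by apply: measurableT_comp.
have indE B : measurable B -> mfrestr mE PE B = \int[P]_(w in B) (\1_E w : R)%:E.
  by move=> mB; rewrite integral_indic//= /mfrestr /mrestr setIC.
(* The restriction is read as [mfrestr], which carries the finiteness that [density_ge0_integral]
   asks for. *)
rewrite -[LHS]/(\int[mfrestr mE PE]_(w in X @^-1` A) (g \o X) w).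
rewrite (density_ge0_integral P (mfrestr mE PE) (\1_E : T -> R) _ indE)//; last first.
  by move=> x; exact: g0.
rewrite setIC integral_mkcondr; apply: eq_integral => w _.
by rewrite epatch_indic.
Qed.

Lemma integral_law_on A (g : S -> R) : measurable A -> measurable_fun setT g ->
  \int[law_on P mE X]_(x in A) (g x)%:E = \int[P]_(w in E `&` X @^-1` A) (g (X w))%:E.
Proof.
move=> mA mg.
have mgE : measurable_fun setT (EFin \o g) by exact/measurable_EFinP.
rewrite integralE [RHS]integralE; congr (_ - _).
- apply: (etrans (ge0_integral_law_on A (EFin \o g)^\+ mA _ _)) => //.
    exact: measurable_funepos.
  by apply: eq_integral => w _; rewrite !funeposE.
- apply: (etrans (ge0_integral_law_on A (EFin \o g)^\- mA _ _)) => //.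
    exact: measurable_funeneg.
  by apply: eq_integral => w _; rewrite !funenegE.
Qed.

Lemma integrable_law_on (g : S -> R) : measurable_fun setT g ->
  (law_on P mE X).-integrable setT (EFin \o g) <->
  P.-integrable E (EFin \o (g \o X)).
Proof.
move=> mg.
have mgE : measurable_fun setT (EFin \o g) by exact/measurable_EFinP.
have H : \int[law_on P mE X]_x `|(g x)%:E| = \int[P]_(w in E) `|(g (X w))%:E|.
  rewrite ge0_integral_law_on//; last exact: measurableT_comp.
  by rewrite preimage_setT setIT.
split=> /integrableP[_ oo]; apply/integrableP; split => //.
- by apply/measurable_EFinP/measurable_funTS; exact: measurableT_comp.
- by rewrite -H.
- by rewrite H.
Qed.

End law_on.

(** Rectangles are stable under intersection and generate the product sigma-algebra. As [m] is
    finite, the constant sequence [setT] serves as the exhausting sequence. *)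
Lemma measure_eq_rectangles {d1 d2 : measure_display} {T1 : measurableType d1}
    {T2 : measurableType d2} {R : realType}
    (m m' : {measure set (T1 * T2) -> \bar R}) : (m setT < +oo)%E ->
  (forall A B, measurable A -> measurable B -> m (A `*` B) = m' (A `*` B)) ->
  forall C, measurable C -> m C = m' C.
Proof.
move=> moo mm' C mC.
apply: (measure_unique [set A `*` B | A in measurable & B in measurable]
  (fun=> setT)) => //.
- by rewrite measurable_prod_measurableType.
- move=> _ _ [A1 mA1 [B1 mB1 <-]] [A2 mA2 [B2 mB2 <-]].
  rewrite -setXI; exists (A1 `&` A2); first exact: measurableI.
  by exists (B1 `&` B2) => //; exact: measurableI.
- by move=> _; exists setT => //; exists setT => //; rewrite setXTT.
- by rewrite bigcup_const//; exists 0%N.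
- by move=> _ [A mA [B mB <-]]; exact: mm'.
Qed.

(** The proofs [g0] and [mg] are arguments so that the measure structure can be inferred from the
    term itself. *)
Definition measure_with_density {d : measure_display} {T : measurableType d}
    {R : realType} (mu : {measure set T -> \bar R}) (g : T -> R)
    (g0 : forall x, 0 <= g x) (mg : measurable_fun setT g) : set T -> \bar R :=
  fun A => (\int[mu]_(x in A) (g x)%:E)%E.

Section measure_with_density.
Context {d : measure_display} {T : measurableType d} {R : realType}.
Context (mu : {measure set T -> \bar R}) (g : T -> R).
Context (g0 : forall x, 0 <= g x) (mg : measurable_fun setT g).
Local Open Scope ereal_scope.
Local Notation nu := (measure_with_density mu g g0 mg).

Let nu0 : nu set0 = 0.
Proof. exact: integral_set0. Qed.

Let nu_ge0 A : 0 <= nu A.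
Proof. by apply: integral_ge0 => x _; rewrite lee_fin. Qed.

Let nu_additive : semi_sigma_additive nu.
Proof.
apply: semi_sigma_additive_nng_induced; first exact/measurable_EFinP.
by move=> x; rewrite lee_fin.
Qed.

HB.instance Definition _ := isMeasure.Build _ _ _ nu nu0 nu_ge0 nu_additive.

End measure_with_density.

(** * From a conditional density to a joint density *)

Section conditional_density.
Context {d1 d2 : measure_display} {S : measurableType d1} {W : measurableType d2}.
Context {R : realType} (rho : {finite_measure set (S * W)%type -> \bar R}).
Context (m1 : {finite_measure set S -> \bar R}).
Context (m2 : {sigma_finite_measure set W -> \bar R}) (f : S -> W -> R).
Hypothesis f0 : forall x y, 0 <= f x y.
Hypothesis mf : measurable_fun setT (fun p : S * W => f p.1 p.2).
Hypothesis rhoE : forall A B, measurable A -> measurable B ->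
  (rho (A `*` B) = \int[m1]_(x in A) \int[m2]_(y in B) (f x y)%:E)%E.
Local Open Scope ereal_scope.

(** By Tonelli the measure with density [f] on the product agrees with [rho] on rectangles, and
    [rho] is finite, so rectangles determine it. *)
Lemma joint_density C : measurable C ->
  rho C = \int[m1 \x m2]_(p in C) (f p.1 p.2)%:E.
Proof.
move=> mC; have g0 (p : S * W) : (0 <= f p.1 p.2)%R by exact: f0.
apply: (@measure_eq_rectangles _ _ _ _ _ rho
  (measure_with_density (m1 \x m2) _ g0 mf)) => //.
  by rewrite ltey_eq fin_num_measure.
move=> A B mA mB; rewrite -[LHS]/(rho (A `*` B)) rhoE//= /measure_with_density.
rewrite [RHS]integral_mkcond fubini_tonelli1//=; last 2 first.
- apply/(measurable_restrictT _ (measurableX mA mB)).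
  by apply: measurable_funTS; exact/measurable_EFinP.
- by move=> p; rewrite patchE; case: ifP => // _; rewrite lee_fin.
rewrite [LHS]integral_mkcond; apply: eq_integral => x _.
rewrite /fubini_F patchE; case: ifPn => xA.
  rewrite [LHS]integral_mkcond; apply: eq_integral => y _.
  by rewrite !patchE in_setX /= xA.
rewrite integral0_eq// => y _.
by rewrite patchE in_setX (negbTE xA).
Qed.

End conditional_density.

(** * Existence of conditional probabilities given [X] *)

Section conditional_probability.
Context {d d' : measure_display} {T : measurableType d} {S : measurableType d'}.
Context {R : realType} (P : probability T R) (X : {mfun T >-> S}).
Local Open Scope ereal_scope.

(** The version is the Radon-Nikodym derivative of the law of [X] on [D] with respect to the law of
    [X]. This derivative is finite everywhere, so [fine] does not change it. *)
Lemma cond_prob_exists D : measurable D ->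
  exists2 g : S -> R, (forall x, 0 <= g x)%R &
    is_cond_exp_on P setT (fun w => \1_D w) X g.
Proof.
move=> mD; pose mu := law_on P measurableT X; pose nu := law_on P mD X.
have numu : nu `<< mu.
  apply/null_content_dominatesP => A mA XA0.
  have {}XA0 : P (X @^-1` A) = 0 by rewrite -XA0 /= /law_on setTI.
  apply/eqP; rewrite -measure_le0 -XA0; apply: (@le_measure _ _ _ P); rewrite ?inE//.
  - by apply: measurableI => //; exact: measurable_funPTI.
  - exact: measurable_funPTI.
have [f [f0 ffin fint fE]] :=radon_nikodym_sigma_finite numu.
have fineE : EFin \o (fine \o f) = f by apply/funext => x /=; rewrite fineK.
have mg : measurable_fun setT (fine \o f).
  by apply/measurable_EFinP; rewrite fineE; exact: measurable_int fint.
exists (fine \o f); first by move=> x; exact: fine_ge0.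
split => //.
- by rewrite -[_ \o _]/(EFin \o \1_D); exact: integrable_indic.
- by apply/(integrable_law_on P measurableT X _ mg).1; rewrite fineE.
- move=> B mB; rewrite -(integral_law_on P measurableT X)//.
  under [RHS]eq_integral do rewrite /= fineK//.
  rewrite -fE// integral_indic//=; first by rewrite setTI.
  by rewrite setTI; exact: measurable_funPTI.
Qed.

Lemma cond_prob_setI D g A : measurable D -> measurable A ->
  is_cond_exp_on P setT (fun w => \1_D w) X g ->
  P (D `&` X @^-1` A) = \int[P]_(w in X @^-1` A) (g (X w))%:E.
Proof.
move=> mD mA [_ _ _ _ gE]; have := gE _ mA; rewrite setTI => <-.
rewrite integral_indic//.
exact: measurable_funPTI.
Qed.

End conditional_probability.

(** * Conditional independence as an identity of integrals *)

Section conditional_independence.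
Context {d dX dW : measure_display} {T : measurableType d}.
Context {S : measurableType dX} {TW : measurableType dW} {R : realType}.
Context (P : probability T R) (X : {mfun T >-> S}) (Z : T -> bool) (W : T -> TW).
Hypothesis mZ : forall z, measurable [set w | Z w = z].
Hypothesis ZWX : cond_indep P Z W X.
Local Open Scope ereal_scope.

Lemma cond_indep_prob z (C : set TW) (g : S -> R) (A : set S) :
  measurable C -> measurable (W @^-1` C) -> measurable A ->
  is_cond_exp_on P setT (fun w => \1_C (W w)) X g ->
  P ([set w | Z w = z] `&` W @^-1` C `&` X @^-1` A) =
  \int[P]_(w in [set w | Z w = z] `&` X @^-1` A) (g (X w))%:E.
Proof.
move=> mC mWC mA hg.
have mE := mZ z; have [_ mg _ _ _] := hg.
have mXA : measurable (X @^-1` A) by exact: measurable_funPTI.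
have [g1 g10 hg1] := cond_prob_exists P X _ mE.
have [g12 _ hg12] := cond_prob_exists P X _ (measurableI _ _ mE mWC).
have [_ mg1 _ _ _] := hg1; have [_ mg12 _ _ _] := hg12.
have mX : measurable_fun setT X by exact: measurable_funPT.
rewrite (cond_prob_setI P X _ g12 A (measurableI _ _ mE mWC))//.
rewrite -(integral_law_on P mE X)//.
(* The law of [X] on {Z = z} has density [g1] with respect to the law of [X]. *)
rewrite (density_integral (law_on P measurableT X) (law_on P mE X) g1)//; last first.
  move=> B mB; rewrite (integral_law_on P measurableT X)// setTI.
  by rewrite -(cond_prob_setI P X _ g1 B mE).
rewrite (integral_law_on P measurableT X _ (fun x => g x * g1 x)%R)//; last first.
  exact: measurable_funM.
rewrite setTI; apply: ae_eq_integral => //.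
- by apply/measurable_EFinP/measurable_funTS; exact: measurableT_comp.
- apply/measurable_EFinP/measurable_funTS.
  by apply: measurable_funM; exact: measurableT_comp.
- have hg12' : is_cond_exp_on P setT
      (fun w => \1_[set w' | Z w' = z] w * \1_C (W w))%R X g12.
    suff -> : (fun w => \1_[set w' | Z w' = z] w * \1_C (W w))%R =
      (\1_([set w' | Z w' = z] `&` W @^-1` C) : T -> R) by [].
    by rewrite indicI; apply/funext.
  have := ZWX z C mC g1 g g12 hg1 hg hg12'.
  by apply: filterS => w -> _; rewrite mulrC.
Qed.

End conditional_independence.

(* The library attaches the sigma-finite structure of [\x] to products of
   subprobabilities only, so the structure is packed by hand. *)
Section sigma_finite_product.
Context {d1 d2 : measure_display} {S : measurableType d1} {W : measurableType d2}.
Context {R : realType} (m1 : {sigma_finite_measure set S -> \bar R}).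
Context (m2 : {sigma_finite_measure set W -> \bar R}).
Local Open Scope ereal_scope.

Lemma product_sigma_finite : sigma_finite setT (m1 \x m2).
Proof.
have /sigma_finiteP[F [TF ndF Foo]] := sigma_finiteT m1.
have /sigma_finiteP[G [TG ndG Goo]] := sigma_finiteT m2.
exists (fun n => F n `*` G n).
  rewrite -setXTT TF TG; apply/seteqP; split => [[x y] /= [[i _ Fx] [j _ Gy]]|].
    (* The two coordinates enter at different indices; monotonicity of both sequences places them
       together at the larger one. *)
    exists (maxn i j) => //; split => /=.
    - by move/subsetPset : (ndF _ _ (leq_maxl i j)); exact.
    - by move/subsetPset : (ndG _ _ (leq_maxr i j)); exact.
  by move=> [x y] [n _ [/= ? ?]]; split; exists n.
move=> n; have [mF Fn] := Foo n; have [mG Gn] := Goo n.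
split; first exact: measurableX.
by rewrite product_measure1E// lte_mul_pinfty// ge0_fin_numE.
Qed.

Definition sigma_finite_product : {sigma_finite_measure set (S * W)%type -> \bar R} :=
  HB.pack (m1 \x m2) (Measure_isSigmaFinite.Build _ _ _ (m1 \x m2) product_sigma_finite).

End sigma_finite_product.

(** * Uniqueness of conditional densities, and integration against them *)

Section conditional_density_integral.
Context {d1 d2 : measure_display} {S : measurableType d1} {W : measurableType d2}.
Context {R : realType} (rho : {finite_measure set (S * W)%type -> \bar R}).
Context (m1 : {finite_measure set S -> \bar R}).
Context (m2 : {sigma_finite_measure set W -> \bar R}) (f : S -> W -> R).
Hypothesis f0 : forall x y, 0 <= f x y.
Hypothesis mf : measurable_fun setT (fun p : S * W => f p.1 p.2).
Hypothesis rhoE : forall A B, measurable A -> measurable B ->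
  (rho (A `*` B) = \int[m1]_(x in A) \int[m2]_(y in B) (f x y)%:E)%E.
Local Open Scope ereal_scope.

(** Both functions are densities of the finite measure [rho] with respect to [m1 \x m2], so they are
    integrable with equal integrals over every measurable set. *)
Lemma conditional_density_unique (f' : S -> W -> R) :
  (forall x y, 0 <= f' x y)%R ->
  measurable_fun setT (fun p : S * W => f' p.1 p.2) ->
  (forall A B, measurable A -> measurable B ->
    rho (A `*` B) = \int[m1]_(x in A) \int[m2]_(y in B) (f' x y)%:E) ->
  {ae (m1 \x m2), forall p, f p.1 p.2 = f' p.1 p.2}.
Proof.
move=> f'0 mf' rhoE'.
have mfE : measurable_fun setT (fun p : S * W => (f p.1 p.2)%:E).
  exact/measurable_EFinP.
have mfE' : measurable_fun setT (fun p : S * W => (f' p.1 p.2)%:E).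
  exact/measurable_EFinP.
suff : ae_eq (m1 \x m2) setT (fun p => (f p.1 p.2)%:E) (fun p => (f' p.1 p.2)%:E).
  by apply: filterS => p /(_ I) [].
apply: integral_ae_eq => //.
- apply/integrableP; split => //.
  under eq_integral do rewrite gee0_abs ?lee_fin//.
  rewrite -(joint_density rho m1 m2 f f0 mf rhoE)//.
  by rewrite ltey_eq fin_num_measure.
- move=> C _ mC; rewrite -(joint_density rho m1 m2 f f0 mf rhoE)//.
  by rewrite -(joint_density rho m1 m2 f' f'0 mf' rhoE').
Qed.

Lemma conditional_density_integrable (phi : S * W -> R) : measurable_fun setT phi ->
  rho.-integrable setT (EFin \o phi) ->
  (m1 \x m2).-integrable setT (fun p => (phi p * f p.1 p.2)%:E).
Proof.
move=> mphi irho; have g0 (p : S * W) : (0 <= f p.1 p.2)%R by [].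
exact: (density_integrable (sigma_finite_product m1 m2) rho _ g0 mf
  (joint_density rho m1 m2 f f0 mf rhoE) phi mphi).1 irho.
Qed.

Lemma conditional_density_integral (phi : S * W -> R) : measurable_fun setT phi ->
  \int[rho]_p (phi p)%:E = \int[m1 \x m2]_p (phi p * f p.1 p.2)%:E.
Proof.
move=> mphi; have g0 (p : S * W) : (0 <= f p.1 p.2)%R by [].
exact: (density_integral (sigma_finite_product m1 m2) rho _ g0 mf
  (joint_density rho m1 m2 f f0 mf rhoE)).
Qed.

End conditional_density_integral.

(** * Null sets of a product measure and their sections *)

Section null_sections.
Context {d1 d2 : measure_display} {S : measurableType d1} {W : measurableType d2}.
Context {R : realType} (m1 : {sigma_finite_measure set S -> \bar R}).
Context (m2 : {sigma_finite_measure set W -> \bar R}).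
Local Open Scope ereal_scope.

(** The measure of a null set [N] is the integral of the nonnegative measures of its sections, so
    almost all of these vanish. *)
Lemma ae_xsection (Q : S * W -> Prop) : {ae (m1 \x m2), forall p, Q p} ->
  {ae m1, forall x, {ae m2, forall y, Q (x, y)}}.
Proof.
move=> [N [mN N0 QN]].
have : ae_eq m1 setT (m2 \o xsection N) (cst 0).
  apply/ae_eq_integral_abs => //; first exact: measurable_fun_xsection.
  rewrite -[RHS]N0; apply: eq_integral => x _.
  by rewrite gee0_abs.
apply: filterS => x /(_ I) /= xN0; exists (xsection N x); split => //.
  exact: measurable_xsection.
by move=> y /= nQ; rewrite /xsection /= inE; exact: QN.
Qed.

(** By uniqueness of the product measure, it can be computed by integrating over [y] the measures of
    the [y]-sections. *)
Lemma product_measure_null_ysection (C : set (S * W)) : measurable C ->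
  (forall y, m1 (ysection C y) = 0) -> (m1 \x m2) C = 0.
Proof.
move=> mC C0.
rewrite (@product_measure_unique _ _ _ _ _ m1 m2 (m1 \x^ m2))//; last first.
  by move=> A B mA mB; exact: product_measure2E.
by apply: integral0_eq => y _; exact: C0.
Qed.

Lemma ae_pair (Q1 : S -> Prop) (Q2 : W -> Prop) :
  {ae m1, forall x, Q1 x} -> {ae m2, forall y, Q2 y} ->
  {ae (m1 \x m2), forall p, Q1 p.1 /\ Q2 p.2}.
Proof.
move=> [N1 [mN1 N10 QN1]] [N2 [mN2 N20 QN2]].
exists ((N1 `*` setT) `|` (setT `*` N2)); split.
- by apply: measurableU; exact: measurableX.
- apply/(negligibleP (m1 \x m2)); first by apply: measurableU; exact: measurableX.
  apply: negligibleU; apply/negligibleP; try exact: measurableX.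
  + apply: (etrans (product_measure1E m1 m2 mN1 measurableT)).
    by rewrite [X in X * _]N10 mul0e.
  + apply: (etrans (product_measure1E m1 m2 measurableT mN2)).
    by rewrite [X in _ * X]N20 mule0.
- move=> [x y] /= /not_andP[nQ|nQ]; [left|right]; split => //=.
  + exact: QN1.
  + exact: QN2.
Qed.

End null_sections.

(** * Overlap and null events of [X] *)

Section overlap.
Context {d dX : measure_display} {T : measurableType d} {S : measurableType dX}.
Context {R : realType} (P : probability T R).
Local Open Scope ereal_scope.

Lemma integral_pos_eq0 (D : set T) (h : T -> R) : measurable D ->
  measurable_fun setT h -> {ae P, forall w, 0 < h w}%R ->
  \int[P]_(w in D) (h w)%:E = 0 -> P D = 0.
Proof.
move=> mD mh h0 hD.
have mhE : measurable_fun D (EFin \o h).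
  by apply/measurable_EFinP; exact: measurable_funTS.
have : \int[P]_(w in D) `|(h w)%:E| = 0.
  rewrite -hD; apply: ae_eq_integral => //; first exact: measurableT_comp.
  by apply: filterS h0 => w hw _ /=; rewrite gtr0_norm.
move/(ae_eq_integral_abs P mD mhE) => hD0.
apply/negligibleP => //.
suff : {ae P, forall w, ~ D w} by apply: negligibleS => w Dw; apply.
by apply: filterS2 hD0 h0 => w h1 h2 Dw; move: h2; case: (h1 Dw) => ->; rewrite ltxx.
Qed.

Lemma overlap_null (X : {mfun T >-> S}) (Z : T -> bool) (N : set S) (z : bool) :
  (forall z, measurable [set w | Z w = z]) ->
  (forall pi : S -> R,
     is_cond_exp_on P setT (fun w => \1_[set w' | Z w'] w) X pi ->
     {ae P, forall w, 0 < pi (X w) < 1}%R) ->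
  measurable N -> P ([set w | Z w = z] `&` X @^-1` N) = 0 ->
  P (X @^-1` N) = 0.
Proof.
move=> mZ overlap mN PN.
have mXN : measurable (X @^-1` N) by exact: measurable_funPTI.
have [g _ hg] := cond_prob_exists P X _ (mZ true).
have [_ mg _ ig _] := hg.
have mgX : measurable_fun setT (g \o X) by exact: measurableT_comp.
have gN := cond_prob_setI P X _ g N (mZ true) mN hg.
have ov := overlap g hg.
case: z PN => PN.
  apply: (integral_pos_eq0 _ (g \o X)) => //.
    by apply: filterS ov => w /= /andP[].
  by rewrite -gN.
have PT : P (X @^-1` N) = P ([set w | Z w = true] `&` X @^-1` N).
  rewrite [in LHS](_ : X @^-1` N = ([set w | Z w = true] `&` X @^-1` N) `|`
    ([set w | Z w = false] `&` X @^-1` N)); last first.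
    apply/seteqP; split => [w Nw|w [] []//].
    by case: (boolP (Z w)) => Zw; [left|right]; split => //=; exact/negbTE.
  rewrite measureU; [|exact: measurableI|exact: measurableI|]; last first.
    by apply/seteqP; split => // w [[/= -> _] []].
  by rewrite [X in _ + X]PN adde0.
apply: (integral_pos_eq0 _ (fun w => 1 - g (X w))%R) => //.
- exact: measurable_funB.
- by apply: filterS ov => w /= /andP[_]; rewrite subr_gt0.
- under eq_integral do rewrite EFinB.
  rewrite integralB//; last 2 first.
  + exact: finite_measure_integrable_cst.
  + exact: (integrableS measurableT).
  rewrite integral_cst// mul1e -gN [Y in Y - _]PT subee// fin_num_measure//.
  exact: measurableI.
Qed.

End overlap.

Lemma measurable_eq_set {d : measure_display} {T : measurableType d} {R : realType}
    (f g : T -> R) : measurable_fun setT f -> measurable_fun setT g ->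
  measurable [set x | f x = g x].
Proof.
move=> mf mg; rewrite (_ : [set x | _] = (fun x => f x == g x) @^-1` [set true]).
  by rewrite -[Y in measurable Y]setTI; exact: measurable_fun_eqr.
by apply/seteqP; split => x /= /eqP.
Qed.

Lemma measurable_fun_integral_in {d1 d2 : measure_display} {S : measurableType d1}
    {W : measurableType d2} {R : realType}
    (m2 : {sigma_finite_measure set W -> \bar R}) (f : S -> W -> R) (B : set W) :
  (forall x y, 0 <= f x y) -> measurable_fun setT (fun p : S * W => f p.1 p.2) ->
  measurable B -> measurable_fun setT (fun x => \int[m2]_(y in B) (f x y)%:E)%E.
Proof.
move=> f0 mf mB.
rewrite (_ : (fun x => _) = fubini_F m2 (fun p => (f p.1 p.2 * \1_B p.2)%:E)).
  apply: measurable_fun_fubini_tonelli_F.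
  - apply/measurable_EFinP; apply: measurable_funM => //.
    exact: measurableT_comp.
  - by move=> p; rewrite lee_fin mulr_ge0.
apply/funext => x; rewrite integral_mkcond; apply: eq_integral => y _.
by rewrite patchE indicE; case: ifP => _ /=; rewrite ?mulr1 ?mulr0.
Qed.

(** * Transfer from an event [E], later {Z = z}, to the whole space; [Mo] is the observed and [M]
    the potential variable *)

Section transfer.
Context {d dX dW : measure_display} {T : measurableType d} {S : measurableType dX}.
Context {TW : measurableType dW} {R : realType} (P : probability T R).
Context (X : {mfun T >-> S}) (M : {mfun T >-> TW}) (Mo : T -> TW).
Context (E : set T) (mE : measurable E).
Local Open Scope ereal_scope.
Hypothesis MoE : forall w, E w -> Mo w = M w.
Hypothesis indepE : forall (B : set TW) (g : S -> R) (A : set S),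
  measurable B -> measurable A ->
  is_cond_exp_on P setT (fun w => \1_B (M w)) X g ->
  P (E `&` M @^-1` B `&` X @^-1` A) = \int[P]_(w in E `&` X @^-1` A) (g (X w))%:E.
Hypothesis overlapE : forall N : set S, measurable N ->
  P (E `&` X @^-1` N) = 0 -> P (X @^-1` N) = 0.

Let PX := law_on P measurableT X.

Let obs_preimage (A : set T) B : E `&` A `&` Mo @^-1` B = E `&` M @^-1` B `&` A.
Proof.
apply/seteqP; split => w /= [[Ew ?]]; first by rewrite MoE.
by move=> ?; rewrite MoE.
Qed.

Lemma ae_law_on_setT (Q : set S) : measurable Q ->
  {ae law_on P mE X, forall x, Q x} -> {ae PX, forall x, Q x}.
Proof.
move=> mQ /negligibleP; rewrite -/(~` Q) => /(_ (measurableC mQ)) Q0.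
apply/negligibleP; first exact: measurableC.
rewrite /PX -[LHS]/(P (setT `&` X @^-1` ~` Q)) setTI.
by apply: overlapE => //; exact: measurableC.
Qed.

(** Over [E] and {X in A}, both functions integrate to P(E, M in B, X in A): [g'] because [Mo] is
    [M] on [E], [g] by [indepE]. They agree almost everywhere for the law of [X] on [E], and overlap
    extends this to the law of [X]. *)
Lemma cond_prob_transfer (B : set TW) (g g' : S -> R) : measurable B ->
  is_cond_exp_on P setT (fun w => \1_B (M w)) X g ->
  is_cond_exp_on P E (fun w => \1_B (Mo w)) X g' ->
  {ae PX, forall x, g' x = g x}.
Proof.
move=> mB hg [_ mg' _ ig' g'E]; have [_ mg _ ig _] := hg.
apply: ae_law_on_setT.
  exact: measurable_eq_set.
have : ae_eq (law_on P mE X) setT (EFin \o g') (EFin \o g).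
  apply: integral_ae_eq => //.
  - exact/(integrable_law_on P mE X).
  - exact/measurable_EFinP.
  - move=> A _ mA; rewrite !(integral_law_on P mE X)//.
    rewrite -g'E// -(indepE B)//.
    have -> : \int[P]_(w in E `&` X @^-1` A) (\1_B (Mo w))%:E =
      \int[P]_(w in E `&` X @^-1` A) (\1_(M @^-1` B) w)%:E.
      apply: eq_integral => w; rewrite inE => -[Ew _].
      by rewrite MoE.
    rewrite integral_indic; last 2 first.
    + by apply: measurableI => //; exact: measurable_funPTI.
    + exact: measurable_funPTI.
    by rewrite setICA setIA.
by apply: filterS => x /(_ I) [].
Qed.

(** [indepE] speaks of real-valued conditional probabilities, while the integral of a density over
    [B] may be infinite at some x. Its mean is P(M in B), so this happens only on a null event; the
    second conjunct lets [fine] be removed afterwards. *)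
Lemma cond_density_cond_prob (m2 : {sigma_finite_measure set TW -> \bar R})
    (f : S -> TW -> R) (B : set TW) : measurable B ->
  is_cond_density_on P setT M X m2 f ->
  is_cond_exp_on P setT (fun w => \1_B (M w)) X
    (fun x => fine (\int[m2]_(y in B) (f x y)%:E)) /\
  {ae P, forall w, \int[m2]_(y in B) (f (X w) y)%:E \is a fin_num}.
Proof.
move=> mB [_ mf f0 fE].
pose G x := \int[m2]_(y in B) (f x y)%:E.
have mG : measurable_fun setT G by exact: measurable_fun_integral_in.
have G0 x : 0 <= G x by apply: integral_ge0 => y _; rewrite lee_fin.
have mX : measurable_fun setT X by exact: measurable_funPT.
have mMB : measurable (M @^-1` B) by exact: measurable_funPTI.
have mXA A : measurable A -> measurable (X @^-1` A).
  by move=> mA; rewrite -[Y in measurable Y]setTI; exact: mX.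
have iG : P.-integrable setT (G \o X).
  apply/integrableP; split; first exact: measurableT_comp.
  under eq_integral do rewrite gee0_abs ?G0//.
  have := fE setT B measurableT mB; rewrite preimage_setT !setTI => <-.
  by rewrite ltey_eq fin_num_measure.
have Gfin : {ae P, forall w, G (X w) \is a fin_num}.
  by apply: filterS (integrable_ae measurableT iG) => w /(_ I).
split => //; have mg : measurable_fun setT (fine \o G).
  exact: (measurableT_comp (@fine_measurable R setT measurableT)).
have iGE A : measurable A -> \int[P]_(w in X @^-1` A) G (X w) =
    \int[P]_(w in X @^-1` A) (fine (G (X w)))%:E.
  move=> mA; apply: ae_eq_integral; first exact: mXA.
  - by apply: measurable_funTS; exact: measurableT_comp.
  - by apply/measurable_EFinP/measurable_funTS; exact: (measurableT_comp mg).
  - by apply: filterS Gfin => w Gw _; rewrite fineK.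
split => //.
- by rewrite (_ : _ \o _ = EFin \o \1_(M @^-1` B))//; exact: integrable_indic.
- apply: (le_integrable measurableT _ _ iG).
  + by apply/measurable_EFinP; exact: (measurableT_comp mg).
  + have le_fine (y : \bar R) : `|(fine y)%:E| <= `|y|.
      by case: y => [r| |] //=; rewrite ?normr0 leey.
    by move=> w _; exact: le_fine.
- move=> A mA; rewrite setTI -iGE//.
  have := fE A B mA mB; rewrite !setTI => <-.
  rewrite -(setIC (M @^-1` B)) -integral_indic//; exact: mXA.
Qed.

(** Both [f'] and [f] disintegrate the law of (X, M) on [E], the latter by [indepE] applied to its
    integrals over [B]. Uniqueness gives equality almost everywhere on the product, then on almost
    every section, and overlap replaces the law on [E] by the law of [X]. *)
Lemma cond_density_transfer (m2 : {sigma_finite_measure set TW -> \bar R})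
    (f f' : S -> TW -> R) :
  is_cond_density_on P setT M X m2 f -> is_cond_density_on P E Mo X m2 f' ->
  {ae PX, forall x, {ae m2, forall y, f' x y = f x y}}.
Proof.
move=> hf [_ mf' f'0 f'E]; have [_ mf f0 _] := hf.
have mXM : measurable_fun setT (fun w => (X w, M w)) by exact: measurable_fun_pair.
pose XM : {mfun T >-> (S * TW)%type} := HB.pack (fun w => (X w, M w))
  (isMeasurableFun.Build _ _ _ _ _ mXM).
have rhoE A B : law_on P mE XM (A `*` B) = P (E `&` M @^-1` B `&` X @^-1` A).
  by rewrite /law_on -setIA; congr (P (_ `&` _)); apply/seteqP; split => w /= [].
have law_density (h : S -> TW -> R) A B : (forall x y, 0 <= h x y)%R ->
    measurable_fun setT (fun p : S * TW => h p.1 p.2) ->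
    measurable A -> measurable B ->
    \int[law_on P mE X]_(x in A) \int[m2]_(y in B) (h x y)%:E =
    \int[P]_(w in E `&` X @^-1` A) \int[m2]_(y in B) (h (X w) y)%:E.
  move=> h0 mh mA mB; apply: ge0_integral_law_on => //.
    exact: measurable_fun_integral_in.
  by move=> x; apply: integral_ge0 => y _; rewrite lee_fin.
have ff' : {ae law_on P mE X \x m2, forall p, f' p.1 p.2 = f p.1 p.2}.
  apply: (conditional_density_unique (law_on P mE XM)) => // A B mA mB.
  - rewrite -[LHS]/(law_on P mE XM (A `*` B)) rhoE law_density//.
    by rewrite -f'E// obs_preimage.
  - rewrite -[LHS]/(law_on P mE XM (A `*` B)) rhoE law_density//.
    have [hg gfin] := cond_density_cond_prob m2 f B mB hf.
    rewrite (indepE B _ A mB mA hg); have [_ mg _ _ _] := hg.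
    have mEA : measurable (E `&` X @^-1` A) by apply: measurableI => //; exact: measurable_funPTI.
    apply: ae_eq_integral => //.
    + by apply/measurable_EFinP/measurable_funTS; exact: (measurableT_comp mg).
    + apply: measurable_funTS.
      apply: (measurableT_comp (measurable_fun_integral_in m2 f B f0 mf mB)).
      exact: measurable_funPT.
    + by apply: filterS gfin => w gw _; rewrite fineK.
(* [ae_law_on_setT] takes a measurable set of x, so almost-everywhere equality in y is restated as
   nullity of the section of [C]. *)
pose C := ~` [set p : S * TW | f' p.1 p.2 = f p.1 p.2].
pose Q := [set x | m2 (xsection C x) = 0].
have mC : measurable C.
  by apply: measurableC; exact: measurable_eq_set.
have mQ : measurable Q.
  rewrite -[Y in measurable Y]setTI.
  by apply: measurable_eqe => //; exact: measurable_fun_xsection.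
suff : {ae PX, forall x, Q x}.
  apply: filterS => x Qx; exists (xsection C x).
  by split => //; [exact: measurable_xsection|move=> y /= ny; rewrite /xsection/= inE].
apply: ae_law_on_setT => //.
apply: filterS (ae_xsection _ _ _ ff') => x /negligibleP.
have -> : ~` [set y | f' (x, y).1 (x, y).2 = f (x, y).1 (x, y).2] =
    xsection C x.
  by apply/seteqP; split => y; rewrite /xsection/= inE.
by apply; exact: measurable_xsection.
Qed.

(** The exceptional null set of x depends on y. Joint measurability makes the disagreement set
    measurable; its y-sections are null, so it is null in the product, and so are almost all its
    x-sections. *)
Lemma ae_fiber_eq (m2 : {sigma_finite_measure set TW -> \bar R})
    (g g' : S -> TW -> R) :
  measurable_fun setT (fun p : S * TW => g p.1 p.2) ->
  measurable_fun setT (fun p : S * TW => g' p.1 p.2) ->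
  (forall y, {ae PX, forall x, g' x y = g x y}) ->
  {ae PX, forall x, {ae m2, forall y, g' x y = g x y}}.
Proof.
move=> mg mg' gg'.
apply: (ae_xsection _ _ (fun p : S * TW => g' p.1 p.2 = g p.1 p.2)).
have mC : measurable (~` [set p : S * TW | g' p.1 p.2 = g p.1 p.2]).
  by apply: measurableC; exact: measurable_eq_set.
apply/negligibleP => //; apply: product_measure_null_ysection => // y.
have := gg' y => /negligibleP.
have -> : ~` [set x | g' x y = g x y] =
    ysection (~` [set p : S * TW | g' p.1 p.2 = g p.1 p.2]) y.
  by apply/seteqP; split => x; rewrite /ysection/= inE.
by apply; exact: measurable_ysection.
Qed.

End transfer.

(** * Expectations as iterated integrals against a conditional density *)

Lemma measurable_fun_section_integral {d1 d2 : measure_display} {S : measurableType d1}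
    {W : measurableType d2} {R : realType}
    (m2 : {sigma_finite_measure set W -> \bar R}) (psi : S * W -> R) :
  measurable_fun setT psi ->
  measurable_fun setT (fun x => \int[m2]_y (psi (x, y))%:E)%E.
Proof.
move=> mpsi; have mpsiE : measurable_fun setT (EFin \o psi) by exact/measurable_EFinP.
rewrite (_ : (fun x => _) =
    (fubini_F m2 (EFin \o psi)^\+ \- fubini_F m2 (EFin \o psi)^\-)%E).
  by apply: emeasurable_funB; apply: measurable_fun_fubini_tonelli_F => //;
    [exact: measurable_funepos|exact: measurable_funeneg].
apply/funext => x; rewrite integralE; congr (_ - _)%E; apply: eq_integral => y _.
- by rewrite !funeposE.
- by rewrite !funenegE.
Qed.

(** The joint law of (X, U) has density [e], so Fubini gives the iterated integral with [e]; then
    [e'] replaces [e] inside the inner integral, for almost every x. *)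
Lemma expectation_cond_density {d dX dW : measure_display} {T : measurableType d}
    {S : measurableType dX} {W : measurableType dW} {R : realType}
    (P : probability T R) (X : {mfun T >-> S}) (U : {mfun T >-> W})
    (m2 : {sigma_finite_measure set W -> \bar R}) (e e' : S -> W -> R)
    (phi : S * W -> R) :
  is_cond_density_on P setT U X m2 e ->
  measurable_fun setT (fun p : S * W => e' p.1 p.2) ->
  {ae law_on P measurableT X, forall x, {ae m2, forall u, e' x u = e x u}} ->
  measurable_fun setT phi ->
  P.-integrable setT (fun w => (phi (X w, U w))%:E) ->
  Rintegral P setT (fun w => phi (X w, U w)) =
  Rintegral P setT (fun w => Rintegral m2 setT (fun u => phi (X w, u) * e' (X w) u)).
Proof.
move=> [_ me e0 eE] me' ee' mphi iphi.
have mXU : measurable_fun setT (fun w => (X w, U w)) by exact: measurable_fun_pair.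
pose XU : {mfun T >-> (S * W)%type} := HB.pack (fun w => (X w, U w))
  (isMeasurableFun.Build _ _ _ _ _ mXU).
pose rho := law_on P measurableT XU; pose m1 := law_on P measurableT X.
have rhoE A B : measurable A -> measurable B ->
    (rho (A `*` B) = \int[m1]_(x in A) \int[m2]_(y in B) (e x y)%:E)%E.
  move=> mA mB; have -> : rho (A `*` B) = P (setT `&` X @^-1` A `&` U @^-1` B).
    by rewrite /rho /law_on -setIA; congr (P (_ `&` _)); apply/seteqP; split => w /= [].
  rewrite eE//; apply/esym; apply: ge0_integral_law_on => //.
    exact: measurable_fun_integral_in.
  by move=> x; apply: integral_ge0 => y _; rewrite lee_fin.
have irho : rho.-integrable setT (EFin \o phi).
  exact/(integrable_law_on P measurableT XU).
have iphie := conditional_density_integrable rho m1 m2 e e0 me rhoE phi mphi irho.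
have mphie' : measurable_fun setT (fun p : S * W => phi p * e' p.1 p.2).
  exact: measurable_funM.
have mphie : measurable_fun setT (fun p : S * W => phi p * e p.1 p.2).
  exact: measurable_funM.
have iH := integrable_fubini_F iphie.
have mH' := measurable_fun_section_integral m2 _ mphie'.
have mfH' := measurableT_comp (@fine_measurable R setT measurableT) mH'.
congr fine.
transitivity (\int[rho]_p (phi p)%:E)%E.
  by rewrite (integral_law_on P measurableT XU)//= preimage_setT setIT.
rewrite (conditional_density_integral rho m1 m2 e e0 me rhoE)//.
rewrite -integral12_prod_meas1//.
transitivity (\int[m1]_x (fine (\int[m2]_y (phi (x, y) * e' x y)%:E))%:E)%E; last first.
  apply: etrans (integral_law_on P measurableT X _ _ measurableT mfH') _.
  by rewrite preimage_setT setIT.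
apply: ae_eq_integral => //.
- exact: measurable_int iH.
- exact/measurable_EFinP.
(* Fubini makes the inner integral finite for almost every x, and there the [fine] hidden in
   [Rintegral] loses nothing. *)
apply: filterS2 (integrable_ae measurableT iH) ee' => x /(_ I) Hfin eex _.
have HE : (fubini_F m2 (fun p => (phi p * e p.1 p.2)%:E) x =
    \int[m2]_y (phi (x, y) * e' x y)%:E)%E.
  apply: ae_eq_integral => //.
  - by apply/measurable_EFinP; exact: (measurableT_comp mphie).
  - by apply/measurable_EFinP; exact: (measurableT_comp mphie').
  - by apply: filterS eex => y -> _.
by rewrite -HE fineK.
Qed.

(** * Identification of the local principal causal effect *)

Theorem theorem2
  (R : realType) (dT dX : measure_display)
  (T : measurableType dT) (TX : measurableType dX) (P : probability T R)
  (X : T -> TX) (Z : T -> bool) (M1 M0 Y1 Y0 : T -> R)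
  (* measurability and integrability of the primitive variables *)
  (mX : measurable_fun setT X) (mZ : measurable [set w | Z w])
  (mM1 : measurable_fun setT M1) (mM0 : measurable_fun setT M0)
  (iY1 : P.-integrable setT (EFin \o Y1)) (iY0 : P.-integrable setT (EFin \o Y0))
  (* overlap: 0 < P(Z = 1 | X) < 1 a.s. (needed for the conditionings on Z = z) *)
  (overlap : forall pi : TX -> R,
     is_cond_exp_on P setT (fun w => \1_[set w' | Z w'] w) X pi ->
     {ae P, forall w, 0 < pi (X w) < 1})
  (* (A1) Z indep (M0, M1, Y0, Y1) given X *)
  (A1 : cond_indep P Z (fun w => (M0 w, M1 w, Y0 w, Y1 w)) X)
  (* (A2) E(Y_z | X, U) = E(Y_z | X, M_z), U = (M1, M0) *)
  (A2 : forall (z : bool) (nu : TX * (R * R) -> R) (lam : TX * R -> R),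
     is_cond_exp_on P setT (pot z Y1 Y0) (fun w => (X w, (M1 w, M0 w))) nu ->
     is_cond_exp_on P setT (pot z Y1 Y0) (fun w => (X w, pot z M1 M0 w)) lam ->
     {ae P, forall w, nu (X w, (M1 w, M0 w)) = lam (X w, pot z M1 M0 w)})
  (* e_u(x): conditional density of U given X = x *)
  (e : TX -> R * R -> R)
  (he : is_cond_density_on P setT
     (fun w => ((M1 w, M0 w) : (measurableTypeR R * measurableTypeR R)%type)) X (leb2 R) e)
  (* F(M_z = m | X = x) and f(M_z = m | X = x): conditional cdf / density of M_z given X *)
  (FM fM : bool -> TX -> R -> R)
  (mFM : forall z : bool, measurable_fun setT (fun p : TX * R => FM z p.1 p.2))
  (hFM : forall (z : bool) (m : R),
     is_cond_exp_on P setT (fun w => \1_`]-oo, m] (pot z M1 M0 w)) X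
       (fun x => FM z x m))
  (hfM : forall z : bool,
     is_cond_density_on P setT
       (fun w => (pot z M1 M0 w : measurableTypeR R)) X (@lebesgue_measure R) (fM z))
  (* the specified copula density c_rho *)
  (c : R -> R -> R) (hc : is_copula_density c)
  (* (A3) *)
  (A3 : forall (x : TX) (m1 m0 : R),
     e x (m1, m0) = c (FM true x m1) (FM false x m0) * (fM true x m1 * fM false x m0))
  (* mu_z(x, m) = E(Y | X = x, Z = z, M = m) *)
  (mu : bool -> TX -> R -> R)
  (hmu : forall z : bool,
     is_cond_exp_on P [set w | Z w = z] (obs Z Y1 Y0) (fun w => (X w, obs Z M1 M0 w))
       (fun p => mu z p.1 p.2))
  (* F_{zm}(x) = P(M <= m | X = x, Z = z) and f_{zm}(x) = f(M = m | X = x, Z = z) *)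
  (F f : bool -> TX -> R -> R)
  (mF : forall z : bool, measurable_fun setT (fun p : TX * R => F z p.1 p.2))
  (hF : forall (z : bool) (m : R),
     is_cond_exp_on P [set w | Z w = z] (fun w => \1_`]-oo, m] (obs Z M1 M0 w)) X
       (fun x => F z x m))
  (hf : forall z : bool,
     is_cond_density_on P [set w | Z w = z]
       (fun w => (obs Z M1 M0 w : measurableTypeR R)) X (@lebesgue_measure R) (f z))
  (* kernel, bandwidth, target point *)
  (K : R -> R -> R) (hK : is_kernel2 K) (h : R) (hpos : 0 < h) (us : R * R)
  (* regularity: the expectations defining tau_{u*} exist *)
  (ik : P.-integrable setT (fun w => (kwt K h us (M1 w, M0 w))%:E))
  (inum : P.-integrable setT (fun w =>
     ((mu true (X w) (M1 w) - mu false (X w) (M0 w)) * kwt K h us (M1 w, M0 w))%:E)) :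
  Rintegral P setT (fun w =>
      (mu true (X w) (M1 w) - mu false (X w) (M0 w)) * kwt K h us (M1 w, M0 w))
  / Rintegral P setT (fun w => kwt K h us (M1 w, M0 w))
  =
  Rintegral P setT (fun w => Rintegral (leb2 R) setT (fun u =>
      (mu true (X w) u.1 - mu false (X w) u.2) * e_id c F f (X w) u * kwt K h us u))
  / Rintegral P setT (fun w => Rintegral (leb2 R) setT (fun u =>
      e_id c F f (X w) u * kwt K h us u)).
Proof.
pose Xm : {mfun T >-> TX} := HB.pack X (isMeasurableFun.Build _ _ _ _ _ mX).
have mZz z : measurable [set w | Z w = z].
  case: z => //; rewrite (_ : [set w | _] = ~` [set w | Z w]); first exact: measurableC.
  by apply/seteqP; split => w /=; [move=> ->|move/negP/negbTE].
have mM z : measurable_fun (U := measurableTypeR R) setT (pot z M1 M0).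
  by case: z; [exact: mM1|exact: mM0].
(* (A1) concerns the whole quadruple; [pz z] extracts its M_z coordinate, which makes an event of
   M_z an event of the quadruple. *)
pose pz z (t : R * R * R * R) := if z then t.1.1.2 else t.1.1.1.
have mpz z : measurable_fun setT (pz z).
  have mfst2 : measurable_fun setT (fun t : R * R * R * R => t.1.1).
    by apply: (measurableT_comp measurable_fst); exact: measurable_fst.
  by case: z; apply: measurableT_comp mfst2.
have pzE z : pz z \o (fun w => (M0 w, M1 w, Y0 w, Y1 w)) = pot z M1 M0 by case: z.
pose M z : {mfun T >-> measurableTypeR R} :=
  HB.pack (pot z M1 M0) (isMeasurableFun.Build _ _ _ _ _ (mM z)).
have obsE z w : [set w | Z w = z] w -> obs Z M1 M0 w = M z w.
  by rewrite /obs /M /= => ->; case: z.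
have indepE z (B : set (measurableTypeR R)) (g : TX -> R) A :
    measurable B -> measurable A ->
    is_cond_exp_on P setT (fun w => \1_B (M z w)) Xm g ->
    P ([set w | Z w = z] `&` M z @^-1` B `&` Xm @^-1` A) =
    (\int[P]_(w in [set w | Z w = z] `&` Xm @^-1` A) (g (Xm w))%:E)%E.
  move=> mB mA hg.
  have mC : measurable (pz z @^-1` B) by rewrite -[Y in measurable Y]setTI; exact: mpz.
  have WE : (fun w => (M0 w, M1 w, Y0 w, Y1 w)) @^-1` (pz z @^-1` B) = M z @^-1` B.
    by rewrite -comp_preimage pzE.
  rewrite -WE; apply: (cond_indep_prob P Xm Z _ mZz A1) => //.
    by rewrite WE; exact: measurable_funPTI.
  suff -> : (fun w => \1_(pz z @^-1` B) (M0 w, M1 w, Y0 w, Y1 w)) =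
    (fun w => \1_B (M z w)) :> (T -> R) by [].
  by apply/funext => w; rewrite -[M z w]/(pot z M1 M0 w) -pzE.
have overlapE z N : measurable N -> P ([set w | Z w = z] `&` Xm @^-1` N) = 0%E ->
    P (Xm @^-1` N) = 0%E.
  exact: overlap_null.
(* The conditional cdfs are compared at each fixed m; [ae_fiber_eq] then exchanges the quantifiers
   over x and m. *)
have FE z : {ae law_on P measurableT Xm, forall x,
    {ae (@lebesgue_measure R), forall m, F z x m = FM z x m}}.
  apply: (ae_fiber_eq P Xm (@lebesgue_measure R) (FM z) (F z) (mFM z) (mF z)) => m.
  have mI : measurable (`]-oo, m]%classic : set (measurableTypeR R)).
    exact: measurable_itv.
  exact: (cond_prob_transfer P Xm (M z) _ _ (mZz z) (obsE z) (indepE z) (overlapE z)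
    `]-oo, m]%classic (FM z ^~ m) (F z ^~ m) mI (hFM z m) (hF z m)).
have fE z : {ae law_on P measurableT Xm, forall x,
    {ae (@lebesgue_measure R), forall m, f z x m = fM z x m}}.
  apply: (cond_density_transfer P Xm (M z) _ _ (mZz z) (obsE z) (indepE z) (overlapE z)).
  - exact: hfM.
  - exact: hf.
(* This is the measure [leb2 R] bundled with its sigma-finiteness. *)
pose leb2s := sigma_finite_product (@lebesgue_measure R) (@lebesgue_measure R).
have Fleb : Filter (nbhs (almost_everywhere (@lebesgue_measure R))).
  exact: (ae_filter_ringOfSetsType (@lebesgue_measure R)).
have eE : {ae law_on P measurableT Xm, forall x, {ae leb2s, forall u,
    e_id c F f x u = e x u}}.
  apply: filterS2 (filterI (FE true) (fE true)) (filterI (FE false) (fE false)).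
  move=> x [F1 f1] [F0 f0].
  have Q1 : {ae (@lebesgue_measure R), forall m,
      F true x m = FM true x m /\ f true x m = fM true x m}.
    by apply: filterS2 F1 f1 => m ? ?; split.
  have Q0 : {ae (@lebesgue_measure R), forall m,
      F false x m = FM false x m /\ f false x m = fM false x m}.
    by apply: filterS2 F0 f0 => m ? ?; split.
  (* The statements on m1 and m0 combine to almost every u in the plane, where (A3) gives [e] the
     same copula formula. *)
  apply: filterS (ae_pair _ _ _ _ Q1 Q0).
  by move=> [m1 m0] /= [[F1E f1E] [F0E f0E]]; rewrite A3 /e_id /= F1E f1E F0E f0E.
pose Um : {mfun T >-> (measurableTypeR R * measurableTypeR R)%type} :=
  HB.pack (fun w => (M1 w, M0 w)) (isMeasurableFun.Build _ _ _ _ _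
    (measurable_fun_pair (mM true) (mM false))).
have mx1 : measurable_fun setT (fun p : TX * (R * R) => (p.1, p.2.1)).
  by apply: measurable_fun_pair => //; apply: measurableT_comp.
have mx0 : measurable_fun setT (fun p : TX * (R * R) => (p.1, p.2.2)).
  by apply: measurable_fun_pair => //; apply: measurableT_comp.
have me_id : measurable_fun setT (fun p : TX * (R * R) => e_id c F f p.1 p.2).
  have [mc _ _ _ _] := hc.
  have [_ mf1 _ _] := hf true; have [_ mf0 _ _] := hf false.
  apply: measurable_funM; last first.
    apply: measurable_funM; first exact: (measurableT_comp mf1 mx1).
    exact: (measurableT_comp mf0 mx0).
  have mFF : measurable_fun setT
      (fun p : TX * (R * R) => (F true p.1 p.2.1, F false p.1 p.2.2)).
    apply: measurable_fun_pair; first exact: (measurableT_comp (mF true) mx1).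
    exact: (measurableT_comp (mF false) mx0).
  exact: (measurableT_comp mc mFF).
have key (phi : TX * (R * R) -> R) : measurable_fun setT phi ->
    P.-integrable setT (fun w => (phi (X w, (M1 w, M0 w)))%:E) ->
    Rintegral P setT (fun w => phi (X w, (M1 w, M0 w))) =
    Rintegral P setT (fun w => Rintegral (leb2 R) setT (fun u =>
      phi (X w, u) * e_id c F f (X w) u)).
  move=> mphi.
  exact: (expectation_cond_density P Xm Um leb2s e (e_id c F f) phi he me_id eE mphi).
have mk : measurable_fun setT (kwt K h us).
  have [mK _ _] := hK.
  have mlin (a b : R) : measurable_fun setT (fun x : R => a * (x - b)).
    by apply: measurable_funM => //; exact: measurable_funB.
  apply: measurable_funM => //.
  have mscale : measurable_fun setT (fun u : R * R =>
      (h^-1 * (u.1 - us.1), h^-1 * (u.2 - us.2))).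
    by apply: measurable_fun_pair; apply: (measurableT_comp (mlin _ _)).
  exact: (measurableT_comp mK mscale).
have mkp : measurable_fun setT (fun p : TX * (R * R) => kwt K h us p.2).
  exact: measurableT_comp mk _.
(* Numerator and denominator are matched separately by [key], with [phi] the weighted contrast and
   the kernel weight alone. *)
congr (_ / _).
- pose phi (p : TX * (R * R)) :=
    (mu true p.1 p.2.1 - mu false p.1 p.2.2) * kwt K h us p.2.
  have mphi : measurable_fun setT phi.
    have [_ mmu1 _ _ _] := hmu true; have [_ mmu0 _ _ _] := hmu false.
    apply: measurable_funM => //; apply: measurable_funB.
      exact: (measurableT_comp mmu1 mx1).
    exact: (measurableT_comp mmu0 mx0).
  rewrite (key phi mphi inum).
  by apply: eq_Rintegral => w _; apply: eq_Rintegral => u _; rewrite /phi /= mulrAC.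
- rewrite (key (fun p => kwt K h us p.2) mkp ik).
  by apply: eq_Rintegral => w _; apply: eq_Rintegral => u _; rewrite mulrC.
Qed.
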